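(* Let $M^3$ be a translation hypersurface of type 3 in $\mathbb{I}^4$, i.e. $M^3$ is parameterized by $r(u,v,w)=(u+v+w,\,f(u),\,g(v),\,h(w))$ with $f,g,h$ smooth real functions of one variable and $f'\neq0$, $g'\neq 0$. If $M^3$ is flat (its Gauss-Kronecker curvature $K$ vanishes identically), then $M^3$ is a cylindrical hypersurface with non-isotropic rulings. Furthermore, if $K$ is a nonzero constant, then, up to translations of the parameters and additive constants, $$f(u)=\lambda u^{\frac12},\qquad g(v)=\mu v^{\frac12},\qquad h(w)=\xi w^{\frac43},$$ where $\lambda,\mu,\xi\in\mathbb{R}$ and $\lambda\mu\xi\neq0$.
   Context: The isotropic space $\mathbb{I}^4$ is $\mathbb{R}^4$ with affine coordinates $(x_1,\dots,x_4)$ and the degenerate metric $dx_1^2+dx_2^2+dx_3^2$; lines parallel to the $x_4$-axis are isotropic, all other lines are non-isotropic. All hypersurfaces considered have a non-isotropic tangent hyperplane (not parallel to the $x_4$-axis) at each point. For a parameterized hypersurface $r$, let $[g_{ij}]$ be the matrix of the first fundamental form induced by the degenerate metric and $h_{ij}=\det(r_u,r_v,r_w,r_{ij})/\sqrt{\det g_{ij}}$, where $r_{ij}$ are the second partial derivatives of $r$. The (isotropic) Gauss-Kronecker curvature is $K=\det[h_{ij}]/\det[g_{ij}]$. For a type 3 hypersurface as in the claim (with the sign convention used here) $$K=\frac{(h')^2f''g''h''}{(f'g')^3}.$$ A hypersurface is cylindrical with non-isotropic rulings if it is generated by mutually parallel non-isotropic lines. ''Up to translations of the parameters and additive constants'' means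 that each of $f,g,h$ may be replaced by $\varphi(t+t_0)+c$ with $t_0,c\in\mathbb{R}$. The powers $u^{1/2}$, $v^{1/2}$ are real and are understood up to reflection of the argument, i.e. as $(\varepsilon u)^{1/2}$, $(\varepsilon' v)^{1/2}$ with $\varepsilon,\varepsilon'\in\{1,-1\}$; $w^{4/3}=(w^{1/3})^4$ with the real cube root. *)

(* Defs.v *)
From HB Require Import structures.
From mathcomp Require Import all_boot all_order all_algebra.
From mathcomp Require Import all_classical all_reals all_analysis.

Set Implicit Arguments.
Unset Strict Implicit.
Unset Printing Implicit Defensive.

Import Order.TTheory GRing.Theory Num.Theory.
Import numFieldNormedType.Exports.

Local Open Scope classical_set_scope.
Local Open Scope ring_scope.

Section Isotropic4.
Context {R : realType}.

(* The coordinates x_1, ..., x_4 of the isotropic space are numbered 0, ..., 3,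
   and the parameters u, v, w are numbered 0, 1, 2. *)

Definition iso_dot (x y : 'rV[R]_4) : R :=
  \sum_(k < 4 | (k < 3)%N) x 0 k * y 0 k.

(* Isotropic directions are the multiples of the x_4-axis vector; in
   particular a non-isotropic d is nonzero. *)
Definition non_isotropic (d : 'rV[R]_4) : Prop :=
  ~ exists a : R, d = a *: delta_mx 0 ord_max.

Definition partial (i : 'I_3) (r : 'rV[R]_3 -> 'rV[R]_4) (p : 'rV[R]_3) :
  'rV[R]_4 := 'D_(delta_mx 0 i) r p.

Definition first_form (r : 'rV[R]_3 -> 'rV[R]_4) (p : 'rV[R]_3) : 'M[R]_3 :=
  \matrix_(i, j) iso_dot (partial i r p) (partial j r p).

Definition second_form (r : 'rV[R]_3 -> 'rV[R]_4) (p : 'rV[R]_3) : 'M[R]_3 :=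
  \matrix_(i, j)
    (\det (col_mx (\matrix_(k < 3) partial k r p)
                  (partial i (partial j r) p) : 'M[R]_4)
     / Num.sqrt (\det (first_form r p))).

(* For type3 f g h this is h'^2 f'' g'' h'' / |f' g'|^3; dropping the absolute
   value only changes the orientation, i.e. a global sign on a box. *)
Definition gauss_kronecker (r : 'rV[R]_3 -> 'rV[R]_4) (p : 'rV[R]_3) : R :=
  \det (second_form r p) / \det (first_form r p).

Definition open_interval (A : set R) : Prop :=
  [/\ A !=set0, open A & is_interval A].

(* Only the values of f on A matter, since A is open in all uses. *)
Definition smooth_on (A : set R) (f : R -> R) : Prop :=
  forall (n : nat) (x : R), A x -> derivable (derive1n n f) x 1.

Definition box (I J L : set R) : set 'rV[R]_3 :=
  [set p | [/\ I (p 0 0), J (p 0 1) & L (p 0 2%:R)]].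

Definition type3 (f g h : R -> R) (p : 'rV[R]_3) : 'rV[R]_4 :=
  \row_(k < 4) [:: p 0 0 + p 0 1 + p 0 2%:R;
                   f (p 0 0); g (p 0 1); h (p 0 2%:R)]`_k.

(* M is swept out by the parallel segments c + T d, where c ranges over a set
   C; the rulings are entire lines when T is the whole real line. *)
Definition cylindrical (T : set R) (M : set 'rV[R]_4) : Prop :=
  exists (d : 'rV[R]_4) (C : set 'rV[R]_4),
    non_isotropic d /\ M = [set c + t *: d | c in C & t in T].

Definition cbrt (x : R) : R := Num.sg x * `|x| `^ 3^-1.

Lemma cbrtK (x : R) : cbrt x ^+ 3 = x.
Proof.
have -> : cbrt x ^+ 3 = Num.sg x ^+ 3 * (`|x| `^ 3^-1) ^+ 3 by exact: exprMn.
rewrite -(powR_mulrn 3 (powR_ge0 _ _)) -powRrM mulVf ?pnatr_eq0// powRr1//.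
have [->|x0] := eqVneq x 0; first by rewrite normr0 mulr0.
by rewrite sgr_odd//= -numEsg.
Qed.

End Isotropic4.

(* Main.v *)
(** For [type3 f g h] the Gauss-Kronecker curvature is a product
    [F u * G v * H w] of functions of one variable, with [F = f'' / |f'|^3],
    [G = g'' / |g'|^3] and [H = h'^2 h''].  If it vanishes identically, one of
    the factors does, so that one of [f], [g], [h] is affine and the
    hypersurface is ruled in the corresponding parameter direction.  If it is a
    nonzero constant, each factor is a nonzero constant.  The ODEs are then
    solved by first integrals: if [F = k] and [s] is the sign of [f'], then
    [(s / f')^2 + 2 k s u] and [s / f' + k f] are constant; if [H = k], then
    [h'^3 - 3 k w] and [h - h'^4 / (4 k)] are constant. *)
Require Import Defs.
From HB Require Import structures.
From mathcomp Require Import all_boot all_order all_algebra.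
From mathcomp Require Import all_classical all_reals all_analysis.
From mathcomp Require Import ring lra.

Import Order.TTheory GRing.Theory Num.Theory.
Import numFieldNormedType.Exports.

Local Open Scope classical_set_scope.
Local Open Scope ring_scope.

(** * Directional derivatives of row-vector maps, coordinate by coordinate *)

Lemma is_derive_rV {R : realFieldType} {V : normedModType R} {n : nat}
    (M : V -> 'rV[R]_n) (dM : 'rV[R]_n) (x v : V) :
  (forall k, is_derive x v (fun t => M t 0 k) (dM 0 k)) -> is_derive x v M dM.
Proof.
move=> dMk.
have dM' : derivable M x v.
  by apply/derivable_mxP => i k; rewrite (ord1 i); exact: ex_derive.
apply: DeriveDef => //.
by rewrite derive_mx//; apply/rowP => k; rewrite mxE derive_val.
Qed.

(** Moving [p] by [t *: v] moves its [i]-th coordinate by [t *: v 0 i], so the two difference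
    quotients are the same function of [t]. *)
Lemma is_derive_coord {R : realFieldType} {n : nat} (phi : R -> R)
    (p v : 'rV[R]_n) (i : 'I_n) (d : R) :
  is_derive (p 0 i) (v 0 i) phi d -> is_derive p v (fun q => phi (q 0 i)) d.
Proof.
suff E :
    (fun t => t^-1 *: (((fun q : 'rV[R]_n => phi (q 0 i)) \o shift p) (t *: v)
                       - phi (p 0 i))) =
    (fun t => t^-1 *: ((phi \o shift (p 0 i)) (t *: v 0 i) - phi (p 0 i))).
  by move=> [D <-]; split; rewrite /derivable/derive E.
by apply/funext => t /=; rewrite !mxE.
Qed.

Lemma is_derive_coord_delta {R : realFieldType} {n : nat} (phi : R -> R)
    (p : 'rV[R]_n) (i j : 'I_n) : derivable phi (p 0 i) 1 ->
  is_derive p (delta_mx 0 j) (fun q => phi (q 0 i))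
    ((j == i)%:R * derive1 phi (p 0 i)).
Proof.
move=> Dphi; apply: is_derive_coord; rewrite mxE eqxx/= [j == i]eq_sym.
case: (i == j); first by rewrite mul1r derive1E; exact: derivableP.
by rewrite mul0r; exact: is_derive0.
Qed.

(** * One-variable calculus on intervals and the differential equations *)

Section Intervals.
Context {R : realType}.
Implicit Types (A : set R) (f : R -> R).

Lemma interval_segment A x y z : is_interval A -> A x -> A y ->
  z \in `[x, y]%R -> A z.
Proof. by move=> itvA Ax Ay; rewrite in_itv/= => xzy; exact: itvA xzy. Qed.

(** By the mean value theorem. Every first integral below is turned into an equality between two
    points through this lemma. *)
Lemma is_derive_0_interval_cst A f : is_interval A ->
  (forall x, A x -> is_derive x 1 f 0) ->
  forall x y, A x -> A y -> f x = f y.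
Proof.
move=> itvA df x y.
wlog xy : x y / x <= y.
  by move=> H Ax Ay; case: (leP x y) => [|/ltW] ?; [|symmetry]; exact: H.
move=> Ax Ay; have inA z : z \in `[x, y]%R -> A z by exact: interval_segment.
have [z zxy||z _] := @MVT_segment R f (fun=> 0) x y xy.
- by apply/df/inA; exact: subset_itv_oo_cc.
- by apply: derivable_within_continuous => z /inA /df [].
- by rewrite mul0r => /eqP; rewrite subr_eq0 => /eqP.
Qed.

Lemma interval_constant_sign A f : open_interval A ->
  (forall x, A x -> derivable f x 1) -> (forall x, A x -> f x != 0) ->
  exists2 s : R, s = 1 \/ s = -1 & forall x, A x -> 0 < s * f x.
Proof.
move=> [[a Aa] _ itvA] df f0.
have pos x y : A x -> A y -> 0 < f x -> 0 < f y.
  move=> Ax Ay fx0; rewrite ltNge; apply/negP => fy0.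
  (* Bracketing 0 by the minimum and the maximum of the end values makes the condition symmetric, so
     it serves whichever of [x] and [y] lies on the left. *)
  have zero u v : A u -> A v -> u <= v -> Num.min (f u) (f v) <= 0 <=
      Num.max (f u) (f v) -> exists2 c, A c & f c = 0.
    move=> Au Av uv fuv; have inA z := interval_segment A u v z itvA Au Av.
    have [|c /inA] := @IVT R f u v 0 uv _ fuv; last by exists c.
    by apply: derivable_within_continuous => z /inA/df.
  have [c Ac fc] : exists2 c, A c & f c = 0.
    by have [xy|/ltW yx] := leP x y; [apply: (zero x y)|apply: (zero y x)];
      rewrite // ge_min le_max fy0 (ltW fx0) ?orbT.
  by have := f0 c Ac; rewrite fc eqxx.
have [fa|fa] := ltP 0 (f a).
  by exists 1; [left|move=> x Ax; rewrite mul1r; exact: pos fa].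
exists (-1); first by right.
move=> x Ax; rewrite mulN1r oppr_gt0 lt_neqAle f0//= leNgt; apply/negP => fx.
by have := pos _ _ Ax Aa fx; rewrite ltNge fa.
Qed.

Lemma smooth_on_is_derive A f x : smooth_on A f -> A x ->
  is_derive x 1 f (derive1 f x) /\
  is_derive x 1 (derive1 f) (derive1 (derive1 f) x).
Proof.
move=> sf Ax; split; rewrite derive1E; apply: derivableP.
  exact: (sf 0%N).
exact: (sf 1%N).
Qed.

Lemma cube_inj (x y : R) : x ^+ 3 = y ^+ 3 -> x = y.
Proof.
move=> xy; apply/eqP; rewrite -subr_eq0.
(* From 4(x^2 + xy + y^2) = (x - y)^2 + 3(x + y)^2: both terms are nonnegative, so both vanish. *)
have : (x - y) ^+ 4 + 3 * ((x - y) * (x + y)) ^+ 2 = 0.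
  transitivity (4 * (x - y) * (x ^+ 3 - y ^+ 3)); first by ring.
  by rewrite xy subrr mulr0.
move/eqP; rewrite paddr_eq0; last by rewrite mulr_ge0// sqr_ge0.
  by rewrite !expf_eq0/= subr_eq0 => /andP[].
exact: exprn_even_ge0.
Qed.

(** The hypothesis says that f'^3 has derivative 0. Working with the cube avoids dividing by f',
    which may vanish; injectivity of cubing then makes f' itself constant. *)
Lemma affine_of_cube_derivative A f : is_interval A -> smooth_on A f ->
  (forall x, A x -> derive1 f x ^+ 2 * derive1 (derive1 f) x = 0) ->
  exists a, forall x y, A x -> A y -> f y = f x + (y - x) * a.
Proof.
move=> itvA sf f'f''0.
have f'E x y : A x -> A y -> derive1 f x = derive1 f y.
  move=> Ax Ay; apply: cube_inj; move: x y Ax Ay.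
  apply: is_derive_0_interval_cst => // x Ax.
  have [_ df'] := smooth_on_is_derive _ _ _ sf Ax.
  apply: is_derive_eq; rewrite /GRing.scale/=.
  by rewrite -[RHS](mulr0 3) -(f'f''0 x Ax); ring.
(* [A] may be empty here, and then any slope will do. *)
have [[a Aa]|A0] := pselect (exists a, A a); last first.
  by exists 0 => x y Ax; case: A0; exists x.
exists (derive1 f a) => x y Ax Ay.
suff : f x - x * derive1 f a = f y - y * derive1 f a by move=> ?; lra.
move: x y Ax Ay; apply: is_derive_0_interval_cst => // z Az.
have [dfz _] := smooth_on_is_derive _ _ _ sf Az.
apply: is_derive_eq; rewrite (f'E _ _ Az Aa).
by rewrite /= scaler0 add0r [_ *: _]mulr1 subrr.
Qed.

(** With w = 1/|f'|, the equation makes w + k f constant and w^2 affine in x. Eliminating w shows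
    that f is, up to a constant, a multiple of the square root of an affine function. *)
Lemma half_power_solution A f (k : R) : open_interval A -> smooth_on A f ->
  (forall x, A x -> derive1 f x != 0) -> k != 0 ->
  (forall x, A x -> derive1 (derive1 f) x / `|derive1 f x| ^+ 3 = k) ->
  exists lambda e x0 c : R, [/\ lambda != 0, e = 1 \/ e = -1 &
    forall x, A (x + x0) ->
      0 <= e * x /\ f (x + x0) + c = lambda * Num.sqrt (e * x)].
Proof.
move=> oA sf f'0 k0 fk; have [[a Aa] _ itvA] := oA.
have [s s1 sf'] : exists2 s : R,
    s = 1 \/ s = -1 & forall x, A x -> 0 < s * derive1 f x.
  by apply: interval_constant_sign => // x; exact: (sf 1%N).
have ss : s * s = 1 by case: s1 => ->; ring.
have s0 : s != 0.
  by apply: contra_eqN ss => /eqP->; rewrite mul0r eq_sym oner_eq0.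
(* As [s * derive1 f x] is positive, it equals |f'|, which removes the absolute value from the
   equation. *)
have f''E x : A x -> derive1 (derive1 f) x = k * (s * derive1 f x) ^+ 3.
  move=> Ax; rewrite -(fk x Ax) -[s * _]gtr0_norm ?sf'// normrM.
  have -> : `|s| = 1 by case: s1 => ->; rewrite ?normrN normr1.
  by rewrite mul1r divfK// expf_neq0// normr_eq0 f'0.
pose w x := s / derive1 f x.
have w0 x : A x -> 0 < w x.
  have sV : s^-1 = s by case: s1 => ->; rewrite ?invrN invr1.
  by move=> Ax; have := sf' x Ax; rewrite -invr_gt0 invfM sV.
have dw x : A x -> is_derive x 1 w (- k * derive1 f x).
  move=> Ax; have [_ df'] := smooth_on_is_derive _ _ _ sf Ax.
  have Dinv := is_deriveV (f'0 x Ax) df'.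
  apply: is_derive_eq; rewrite /GRing.scale/= f''E//.
  (* Differentiating [w] produces s^4 on the left; the right side is multiplied by (s s)(s s) = 1 to
     match. *)
  by rewrite -[RHS]mul1r -(mulr1 1) -{1 2}ss; field; exact: f'0.
have dC : forall x y, A x -> A y -> w x + k * f x = w y + k * f y.
  apply: is_derive_0_interval_cst => // x Ax.
  have [df _] := smooth_on_is_derive _ _ _ sf Ax; have dwx := dw x Ax.
  by apply: is_derive_eq; rewrite /GRing.scale/=; ring.
have dW : forall x y, A x -> A y ->
    w x ^+ 2 + 2 * k * s * x = w y ^+ 2 + 2 * k * s * y.
  apply: is_derive_0_interval_cst => // x Ax.
  have dwx := dw x Ax.
  by apply: is_derive_eq; rewrite /GRing.scale/= /w; field; exact: f'0.
have ks0 : 2 * k * s != 0 by rewrite !mulf_neq0// pnatr_eq0.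
(* The zero of the affine function that w^2 agrees with on [A]: after the shift, w(x + x0)^2 = - 2 k
   s x. *)
set x0 := (w a ^+ 2 + 2 * k * s * a) / (2 * k * s).
set C := w a + k * f a.
have k2 : 0 < 2 * `|k| by rewrite mulr_gt0// normr_gt0.
have q0 : Num.sqrt (2 * `|k|) != 0 by rewrite sqrtr_eq0 -ltNge.
(* With k = sgn(k) |k|, the shifted relation reads w^2 = 2 |k| e x for e = - s sgn(k). Taking the
   root and inserting it in f - C / k = - w / k gives the coefficient. *)
exists (- Num.sqrt (2 * `|k|) / k), (- (s * Num.sg k)), x0, (- (C / k)); split.
- by rewrite mulf_neq0 ?oppr_eq0 ?invr_eq0.
- by case: s1 => ->; case: sgrP k0 => // _ _; [right|left|left|right]; ring.
move=> x Ax.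
have exE : - (s * Num.sg k) * x = w (x + x0) ^+ 2 / (2 * `|k|).
  apply: (mulIf (lt0r_neq0 k2)); rewrite divfK ?lt0r_neq0//.
  have := dW _ _ Ax Aa.
  have -> : 2 * k * s * (x + x0) = 2 * k * s * x + (w a ^+ 2 + 2 * k * s * a).
    by rewrite mulrDr /x0 [X in _ + X]mulrC divfK.
  move=> wE; transitivity (- (2 * (Num.sg k * `|k|) * s * x)); first by ring.
  by rewrite -numEsg; lra.
have w0' := w0 _ Ax.
rewrite exE; split; first by rewrite divr_ge0 ?sqr_ge0 ?ltW.
rewrite [Num.sqrt (_ / _)]sqrtrM ?sqr_ge0// sqrtrV ?ltW// sqrtr_sqr.
rewrite (gtr0_norm w0').
by rewrite /C -(dC _ _ Ax Aa); field; rewrite q0 k0.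
Qed.

(** Here f'^3 is affine with slope 3 k, and f differs from f'^4 / (4 k) by a constant. The real cube
    root thus gives f' and then f, whatever the sign of f'. *)
Lemma four_thirds_power_solution A f (k : R) : open_interval A ->
  smooth_on A f -> k != 0 ->
  (forall x, A x -> derive1 f x ^+ 2 * derive1 (derive1 f) x = k) ->
  exists xi x0 c : R, xi != 0 /\
    forall x, A (x + x0) -> f (x + x0) + c = xi * cbrt x ^+ 4.
Proof.
move=> [[a Aa] _ itvA] sf k0 fk.
have dC : forall x y, A x -> A y ->
    derive1 f x ^+ 3 - 3 * k * x = derive1 f y ^+ 3 - 3 * k * y.
  apply: is_derive_0_interval_cst => // x Ax.
  have [_ df'] := smooth_on_is_derive _ _ _ sf Ax.
  by apply: is_derive_eq; rewrite /GRing.scale/= -(fk x Ax); ring.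
have dF : forall x y, A x -> A y ->
    f x - derive1 f x ^+ 4 / (4 * k) = f y - derive1 f y ^+ 4 / (4 * k).
  apply: is_derive_0_interval_cst => // x Ax.
  have [df df'] := smooth_on_is_derive _ _ _ sf Ax.
  apply: is_derive_eq; rewrite /GRing.scale/=.
  (* Once k is replaced by f'^2 f'', the denominator 4 k contains both factors; they are nonzero
     because k is. *)
  have : derive1 (derive1 f) x != 0 /\ derive1 f x != 0.
    apply/andP; move: k0.
    by rewrite -(fk x Ax) mulf_eq0 expf_eq0/= negb_or andbC.
  by rewrite -(fk x Ax) => -[? ?]; field; apply/andP.
(* The zero of the affine function f'^3, so that f'(x + x0)^3 = 3 k x. *)
pose x0 := a - derive1 f a ^+ 3 / (3 * k).
pose C := f a - derive1 f a ^+ 4 / (4 * k).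
have k3 : 3 * k != 0 by rewrite mulf_neq0// pnatr_eq0.
have c0 : cbrt (3 * k) != 0.
  by apply: contra_neq k3 => c0; rewrite -[LHS]cbrtK c0 expr0n.
exists (cbrt (3 * k) ^+ 4 / (4 * k)), x0, (- C); split.
  apply: mulf_neq0; first exact: expf_neq0.
  by rewrite invr_eq0; apply: mulf_neq0; rewrite ?pnatr_eq0.
move=> x Ax.
have f'E : derive1 f (x + x0) = cbrt (3 * k) * cbrt x.
  apply: cube_inj; rewrite exprMn !cbrtK.
  have := dC _ _ Ax Aa.
  have -> : 3 * k * (x + x0) = 3 * k * x + 3 * k * a - derive1 f a ^+ 3.
    by rewrite /x0; field.
  by move=> ?; lra.
rewrite mulrAC -exprMn -f'E /C -(dF _ _ Ax Aa); ring.
Qed.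

End Intervals.

(** * Partial derivatives, determinants and curvature for type 3 *)

Lemma det_first_form_type3 (R : comRingType) (a b : R) :
  \det (\matrix_(i < 3, j < 3)
    (1 + (i == 0)%:R * a * ((j == 0)%:R * a)
       + (i == 1)%:R * b * ((j == 1)%:R * b))) = (a * b) ^+ 2.
Proof.
rewrite (expand_det_row _ ord0) !big_ord_recl big_ord0 /cofactor.
rewrite !(expand_det_row _ ord0) !big_ord_recl !big_ord0 /cofactor.
by rewrite !det_mx11 !mxE/= /bump/=; ring.
Qed.

(** The first three rows are the tangent vectors r_u, r_v, r_w. The last is a second derivative,
    with first coordinate 0 because u + v + w is linear. *)
Lemma det_tangent_type3 (R : comRingType) (a b c x y z : R) :
  \det (\matrix_(i < 4, j < 4)
    (nth [::] [:: [:: 1; a; 0; 0]; [:: 1; 0; b; 0]; [:: 1; 0; 0; c];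
                  [:: 0; x; y; z]] i)`_j) =
  x * b * c + y * a * c + z * a * b.
Proof.
rewrite (expand_det_row _ ord0) !big_ord_recl big_ord0 /cofactor !mxE/=.
rewrite !mul0r !addr0.
rewrite !(expand_det_row _ ord0) !big_ord_recl !big_ord0 /cofactor !mxE/=.
rewrite !(expand_det_row _ ord0) !big_ord_recl !big_ord0 /cofactor.
by rewrite !det_mx11 !mxE/= /bump/=; ring.
Qed.

Section Type3.
Context {R : realType}.
Context (f g h : R -> R).

(** One shape for the first partials ([a] = 1), the second partials ([a] = 0) and the directions of
    the rulings; [j] is the parameter being varied. *)
Definition tangent_row (a b c d : R) (j : 'I_3) : 'rV[R]_4 :=
  \row_k [:: a; (j == 0)%:R * b; (j == 1)%:R * c; (j == 2%:R)%:R * d]`_k.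

Lemma partial_type3 (j : 'I_3) (p : 'rV[R]_3) :
  derivable f (p 0 0) 1 -> derivable g (p 0 1) 1 -> derivable h (p 0 2%:R) 1 ->
  partial j (type3 f g h) p =
  tangent_row 1 (derive1 f (p 0 0)) (derive1 g (p 0 1))
    (derive1 h (p 0 2%:R)) j.
Proof.
move=> df dg dh; apply: derive_val; apply: is_derive_rV.
have Did i := is_derive_coord_delta (@id R) p i j (@derivable_id _ _ _ _).
have Df := is_derive_coord_delta f p 0 j df.
have Dg := is_derive_coord_delta g p 1 j dg.
have Dh := is_derive_coord_delta h p 2%:R j dh.
move=> -[[|[|[|[|//]]]] ?]; rewrite mxE /=.
- under eq_fun do rewrite mxE /=.
  have := Did 0; have := Did 1; have := Did 2%:R.
  rewrite !derive1_id => D2 D1 D0.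
  apply: is_derive_eq.
  by case: j {Did Df Dg Dh D0 D1 D2} => [[|[|[|//]]] ?]; rewrite /=; ring.
- by under eq_fun do rewrite mxE /=.
- by under eq_fun do rewrite mxE /=.
- by under eq_fun do rewrite mxE /=.
Qed.

End Type3.

Section Curvature.
Context {R : realType}.
Context (I J L : set R) (f g h : R -> R).
Context (oI : open I) (oJ : open J) (oL : open L).
Context (sf : smooth_on I f) (sg : smooth_on J g) (sh : smooth_on L h).

Lemma box_nbhs (p : 'rV[R]_3) : box I J L p -> \near p, box I J L p.
Proof.
have near_coord (A : set R) (i : 'I_3) : open A -> A (p 0 i) ->
    \forall q \near p, A ((q : 'rV[R]_3) 0 i).
  by move=> oA Ap; exact: (coord_continuous (open_nbhs_nbhs (conj oA Ap))).
by move=> [Ip Jp Lp]; near=> q; split; near: q; exact: near_coord.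
Unshelve. all: by end_near. Qed.

Lemma partial2_type3 (i j : 'I_3) (p : 'rV[R]_3) : box I J L p ->
  partial i (partial j (type3 f g h)) p =
  tangent_row 0 ((j == 0)%:R * derive1 (derive1 f) (p 0 0))
    ((j == 1)%:R * derive1 (derive1 g) (p 0 1))
    ((j == 2%:R)%:R * derive1 (derive1 h) (p 0 2%:R)) i.
Proof.
move=> Bp; pose T (q : 'rV[R]_3) := tangent_row 1 (derive1 f (q 0 0))
  (derive1 g (q 0 1)) (derive1 h (q 0 2%:R)) j.
(* Differentiating again requires the formula for the first partial in a neighbourhood of [p], not
   just at [p]; openness of the box supplies it. *)
rewrite {1}/partial (near_eq_derive _ (g := T)); last first.
  apply: filterS (box_nbhs _ Bp) => q [Iq Jq Lq].
  by apply: partial_type3; [exact: (sf 0%N)|exact: (sg 0%N)|exact: (sh 0%N)].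
have [Ip Jp Lp] := Bp; apply: derive_val; apply: is_derive_rV.
have Df := is_derive_coord_delta _ p 0 i (sf 1%N _ Ip).
have Dg := is_derive_coord_delta _ p 1 i (sg 1%N _ Jp).
have Dh := is_derive_coord_delta _ p 2%:R i (sh 1%N _ Lp).
move=> -[[|[|[|[|//]]]] ?]; rewrite mxE /=; under eq_fun do rewrite mxE /=.
- exact: is_derive_cst.
- by apply: is_derive_eq; rewrite /GRing.scale/=; ring.
- by apply: is_derive_eq; rewrite /GRing.scale/=; ring.
- by apply: is_derive_eq; rewrite /GRing.scale/=; ring.
Qed.

(** Each coordinate is a sum of functions of one parameter, so mixed second partials vanish and the
    second form is diagonal. Its diagonal contributes a^2 b^2 c^2, of which c^2 survives division by
    (a b)^2. *)
Lemma gauss_kronecker_type3 (p : 'rV[R]_3) : box I J L p ->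
  derive1 f (p 0 0) != 0 -> derive1 g (p 0 1) != 0 ->
  gauss_kronecker (type3 f g h) p =
  (derive1 (derive1 f) (p 0 0) / `|derive1 f (p 0 0)| ^+ 3) *
  (derive1 (derive1 g) (p 0 1) / `|derive1 g (p 0 1)| ^+ 3) *
  (derive1 h (p 0 2%:R) ^+ 2 * derive1 (derive1 h) (p 0 2%:R)).
Proof.
move=> Bp; have [Ip Jp Lp] := Bp.
have P1 j := partial_type3 f g h j p (sf 0%N _ Ip) (sg 0%N _ Jp) (sh 0%N _ Lp).
have P2 i j := partial2_type3 i j p Bp.
move: P1 P2.
set a := derive1 f _; set b := derive1 g _; set c := derive1 h _.
set x := derive1 (derive1 f) _; set y := derive1 (derive1 g) _.
set z := derive1 (derive1 h) _.
clearbody a b c x y z => P1 P2 a0 b0.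
(* The degenerate metric ignores the fourth coordinate, so h' does not enter. *)
have FE : \det (first_form (type3 f g h) p) = (a * b) ^+ 2.
  rewrite -det_first_form_type3; congr (\det _); apply/matrixP => i j.
  rewrite !mxE /iso_dot big_mkcond !big_ord_recl big_ord0/= !P1 !mxE/=.
  by rewrite mul1r !addr0 addrA.
have SE : second_form (type3 f g h) p =
  diag_mx (\row_i ([:: x * b * c; y * a * c; z * a * b]`_i / `|a * b|)).
  apply/matrixP => i j; rewrite !mxE FE sqrtr_sqr.
  set M := col_mx _ _.
  have -> : M = \matrix_(k, l)
      (nth [::] [:: [:: 1; a; 0; 0]; [:: 1; 0; b; 0]; [:: 1; 0; 0; c];
        [:: 0; (i == 0)%:R * ((j == 0)%:R * x); (i == 1)%:R * ((j == 1)%:R * y);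
               (i == 2%:R)%:R * ((j == 2%:R)%:R * z)]] k)`_l.
    apply/matrixP => k l; rewrite [RHS]mxE [LHS]mxE.
    case: splitP => m /= ->.
      rewrite mxE P1 mxE.
      by case: m => [[|[|[|//]]] ?]; case: l => [[|[|[|[|//]]]] ?];
        rewrite /= ?mul1r ?mul0r.
    by rewrite ord1 P2 mxE.
  rewrite det_tangent_type3 -mulrnAl; congr (_ / _).
  clear M; case: i => [[|[|[|//]]] ?]; case: j => [[|[|[|//]]] ?];
    rewrite /= ?mulr1n ?mulr0n; ring.
rewrite /gauss_kronecker FE SE det_diag !big_ord_recl big_ord0 !mxE/= normrM.
by field; rewrite a0 b0 !normr_eq0 a0 b0.
Qed.

End Curvature.

(** * Rulings along one parameter direction *)

Section Cylinder.
Context {R : realType}.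

Lemma non_isotropic_coord0 (d : 'rV[R]_4) : d 0 0 = 1 -> non_isotropic d.
Proof.
move=> d0 [a dE]; move: d0; rewrite dE !mxE mulr0 => /eqP.
by rewrite eq_sym oner_eq0.
Qed.

Definition set_coord {n : nat} (i : 'I_n) (t : R) (p : 'rV[R]_n) : 'rV[R]_n :=
  \row_k if k == i then t else p 0 k.

(** Each point slides back along [d] to parameter value 0, giving the base set. Since 0 need not
    belong to [T], base points may lie off the hypersurface. *)
Lemma cylindrical_image (T : set R) (B : set 'rV[R]_3)
    (r : 'rV[R]_3 -> 'rV[R]_4) (i : 'I_3) (d : 'rV[R]_4) :
  non_isotropic d ->
  (forall p, B p -> T (p 0 i)) ->
  (forall t p, T t -> B p -> B (set_coord i t p)) ->
  (forall t p, T t -> B p -> r (set_coord i t p) = r p + (t - p 0 i) *: d) ->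
  cylindrical T (r @` B).
Proof.
move=> dn BT TB rE; exists d, [set r p - p 0 i *: d | p in B]; split=> //.
apply/seteqP; split=> [_ [p Bp <-]|_ [_ [p Bp <-] [t Tt <-]]].
  exists (r p - p 0 i *: d); first by exists p.
  by exists (p 0 i); [exact: BT|rewrite subrK].
exists (set_coord i t p); first exact: TB.
by rewrite rE// scalerBl addrA addrAC.
Qed.

End Cylinder.

Theorem theorem5p1 (R : realType) (I J L : set R) (f g h : R -> R)
  (hI : open_interval I) (hJ : open_interval J) (hL : open_interval L)
  (sf : smooth_on I f) (sg : smooth_on J g) (sh : smooth_on L h)
  (f'_neq0 : forall u : R, I u -> derive1 f u != 0)
  (g'_neq0 : forall v : R, J v -> derive1 g v != 0) :
  ((forall p : 'rV[R]_3, box I J L p -> gauss_kronecker (type3 f g h) p = 0) ->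
   exists T : set R,
     [/\ open_interval T,
         (I = setT -> J = setT -> L = setT -> T = setT) &
         cylindrical T (type3 f g h @` box I J L)])
  /\
  (forall K0 : R, K0 != 0 ->
   (forall p : 'rV[R]_3, box I J L p -> gauss_kronecker (type3 f g h) p = K0) ->
   exists lambda mu xi : R, lambda * mu * xi != 0 /\
     [/\ exists e u0 c : R, (e = 1 \/ e = -1) /\
           forall u : R, I (u + u0) ->
             0 <= e * u /\ f (u + u0) + c = lambda * Num.sqrt (e * u),
         exists e v0 c : R, (e = 1 \/ e = -1) /\
           forall v : R, J (v + v0) ->
             0 <= e * v /\ g (v + v0) + c = mu * Num.sqrt (e * v) &
         exists w0 c : R,
           forall w : R, L (w + w0) -> h (w + w0) + c = xi * cbrt w ^+ 4]).

Proof.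
have [[u0 Iu0] oI itvI] := hI.
have [[v0 Jv0] oJ itvJ] := hJ.
have [[w0 Lw0] oL itvL] := hL.
pose F u := derive1 (derive1 f) u / `|derive1 f u| ^+ 3.
pose G v := derive1 (derive1 g) v / `|derive1 g v| ^+ 3.
pose H w := derive1 h w ^+ 2 * derive1 (derive1 h) w.
pose P u v w : 'rV[R]_3 := \row_k [:: u; v; w]`_k.
have boxP u v w : I u -> J v -> L w -> box I J L (P u v w).
  by move=> Iu Jv Lw; split; rewrite mxE.
have KE u v w : I u -> J v -> L w ->
    gauss_kronecker (type3 f g h) (P u v w) = F u * G v * H w.
  move=> Iu Jv Lw; have B := boxP _ _ _ Iu Jv Lw.
  have := gauss_kronecker_type3 _ _ _ _ _ _ oI oJ oL sf sg sh _ B.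
  by rewrite !mxE/= => ->//; [exact: f'_neq0|exact: g'_neq0].
split=> [K0|K0 K0_neq0 KK0].
(* If neither f'' nor g'' vanishes identically, fix [u] and [v] where they are nonzero; the zero
   curvature along these values then forces [H] to vanish on all of [L]. *)
- have [f0|/existsNP[u /not_implyP[Iu /eqP fu]]] :=
    pselect (forall u, I u -> derive1 (derive1 f) u = 0).
    have [|a fE] := affine_of_cube_derivative _ _ itvI sf.
      by move=> u Iu; rewrite f0// mulr0.
    (* The rulings are indexed by the interval of the affine function, hence are entire lines when
       all parameter intervals are the whole line. *)
    exists I; split=> //.
    apply: (cylindrical_image _ _ _ 0 (tangent_row 1 a 0 0 0)).
    + by apply: non_isotropic_coord0; rewrite mxE.
    + by move=> p [].
    + by move=> t p It [Ip Jp Lp]; split; rewrite mxE.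
    + move=> t p It [Ip Jp Lp].
      apply/rowP => -[[|[|[|[|//]]]] ?]; rewrite !mxE/=.
      * by ring.
      * by rewrite (fE _ _ Ip It); ring.
      * by ring.
      * by ring.
  have [g0|/existsNP[v /not_implyP[Jv /eqP gv]]] :=
    pselect (forall v, J v -> derive1 (derive1 g) v = 0).
    have [|a gE] := affine_of_cube_derivative _ _ itvJ sg.
      by move=> v Jv; rewrite g0// mulr0.
    exists J; split=> //.
    apply: (cylindrical_image _ _ _ 1 (tangent_row 1 0 a 0 1)).
    + by apply: non_isotropic_coord0; rewrite mxE.
    + by move=> p [].
    + by move=> t p Jt [Ip Jp Lp]; split; rewrite mxE.
    + move=> t p Jt [Ip Jp Lp].
      apply/rowP => -[[|[|[|[|//]]]] ?]; rewrite !mxE/=.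
      * by ring.
      * by ring.
      * by rewrite (gE _ _ Jp Jt); ring.
      * by ring.
  have H0 w : L w -> derive1 h w ^+ 2 * derive1 (derive1 h) w = 0.
    move=> Lw; have := K0 _ (boxP _ _ _ Iu Jv Lw); rewrite KE// => /eqP.
    rewrite !mulf_eq0 !invr_eq0 !expf_eq0/= !normr_eq0.
    rewrite (negPf fu) (negPf gv) (negPf (f'_neq0 _ Iu)).
    rewrite (negPf (g'_neq0 _ Jv))/=.
    by rewrite orbb => /orP[]/eqP->; rewrite ?mulr0// expr0n mul0r.
  have [a hE] := affine_of_cube_derivative _ _ itvL sh H0.
  exists L; split=> //.
  apply: (cylindrical_image _ _ _ 2%:R (tangent_row 1 0 0 a 2%:R)).
  + by apply: non_isotropic_coord0; rewrite mxE.
  + by move=> p [].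
  + by move=> t p Jt [Ip Jp Lp]; split; rewrite mxE.
  + move=> t p Lt [Ip Jp Lp]; apply/rowP => -[[|[|[|[|//]]]] ?]; rewrite !mxE/=.
    * by ring.
    * by ring.
    * by ring.
    * by rewrite (hE _ _ Lp Lt); ring.
- have FGH u v w : I u -> J v -> L w -> F u * G v * H w = K0.
    by move=> Iu Jv Lw; rewrite -KE// KK0//; exact: boxP.
  have : F u0 * G v0 * H w0 != 0 by rewrite FGH.
  rewrite mulf_eq0 negb_or mulf_eq0 negb_or -andbA => /and3P[F0 G0 H0].
  (* Separation of variables: with the other two parameters frozen at the base point, their nonzero
     factors cancel. *)
  have FE u : I u -> F u = F u0.
    by move=> Iu; apply: (mulIf G0); apply: (mulIf H0); rewrite !FGH.
  have GE v : J v -> G v = G v0.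
    by move=> Jv; apply: (mulfI F0); apply: (mulIf H0); rewrite !FGH.
  have HE w : L w -> H w = H w0.
    by move=> Lw; apply: (mulfI (mulf_neq0 F0 G0)); rewrite !FGH.
  have [lambda [e [x0 [c [l0 e1 fE]]]]] :=
    half_power_solution _ _ _ hI sf f'_neq0 F0 FE.
  have [mu [e' [y0 [c' [m0 e'1 gE]]]]] :=
    half_power_solution _ _ _ hJ sg g'_neq0 G0 GE.
  have [xi [z0 [c'' [xi0 hE]]]] := four_thirds_power_solution _ _ _ hL sh H0 HE.
  exists lambda, mu, xi; split; first by rewrite !mulf_neq0.
  by split; [exists e, x0, c|exists e', y0, c'|exists z0, c''].
Qed.
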